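(* Let $n$ be a positive integer, $p$ a prime number, $q$ a power of $p$ with $\gcd(n,q)=1$, and $U_n$ the set of primitive $n$-th roots of unity. Let $\mathbb{F}_q\subseteq\mathbb{K}\subseteq\mathbb{L}$ be fields with $U_n\subset\mathbb{L}$. Let $g\in\mathbb{K}[x]$ be a divisor of $x^n-1$ with $\deg(g)<n$. If there exist $k\in\{0,\dots,n-1\}$ and $\beta\in U_n$ such that $\varphi^{-1}_{\beta,\overline{x^kg}}\in\mathbb{F}_q(n)$, then there exists a family of permutation equivalent BCH codes $\{C_\alpha=B_q(\alpha,\delta,b) : \alpha\in U_n\}$, with $\delta=n-\deg(g)$ and $b\in\mathbb{Z}_n$, such that for all $\alpha\in U_n$ one has $\delta=\Delta(C_\alpha)=d(C_\alpha)$ and $\varphi^{-1}_{\alpha,\overline{x^kg}}\in C_\alpha$.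
   Context: For a field $F$, $F(n)=F[x]/(x^n-1)$; its elements are identified with polynomials of degree $<n$, and $\overline{f}$ is the image of $f\in F[x]$ in $F(n)$, i.e. its remainder modulo $x^n-1$. A cyclic code is an ideal $C$ of $\mathbb{F}_q(n)$; $d(C)$ is the minimum number of nonzero coefficients of a nonzero element of $C$. Two codes are permutation equivalent if one is obtained from the other by a fixed permutation of the $n$ coordinates (coefficients). The set of zeros $Z(C)$ is the set of $n$-th roots of unity at which all elements of $C$ vanish, and for $\alpha\in U_n$, $D_\alpha(C)=\{i\in\mathbb{Z}_n:\alpha^i\in Z(C)\}$. The BCH bounds of $C$ are the integers $\delta$ such that, for some $\alpha\in U_n$, $D_\alpha(C)$ contains $\delta-1$ consecutive integers modulo $n$; $\Delta(C)$ is the maximum of the BCH bounds of the (nonzero) code $C$. For $\alpha\in U_n$, $\delta\geq 1$ and $b\in\{0,\dots,n-1\}$, the BCH code $B_q(\alpha,\delta,b)$ of designed distance $\delta$ is the cyclic code in $\mathbb{F}_q(n)$ whose generator polynomial is the monic polynomial of lowest degree over $\mathbb{F}_q$ having all $\alpha^{b+j}$, $j=0,\dots,\delta-2$, as zeros; equivalently, it is the cyclic code with $D_\alpha(C)=\bigcup_{j=0}^{\delta-2}C_q(b+j)$, where $C_q(a)=\{a,qa,q^2a,\dots\}\subseteq\mathbb{Z}_n$ is the $q$-cyclotomic coset of $a$ modulo $n$ (for $\delta=1$ it is the whole $\mathbb{F}_q(n)$). For $g\in\mathbb{L}(n)$ and $\alpha\in U_n$, the inverse Fourier transform is $\varphi^{-1}_{\alpha,g}(x)=\frac1n\sum_{i=0}^{n-1}g(\alpha^{-i})x^i\in\mathbb{L}(n)$.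 *)

(* Defs.v *)
From mathcomp Require Import all_boot all_order all_fingroup all_algebra all_field.

Set Implicit Arguments.
Unset Strict Implicit.
Unset Printing Implicit Defensive.

Import GRing.Theory.
Local Open Scope ring_scope.

(* R(n) = R[x]/(x^n - 1).  An element coerces to the polynomial of degree < n
   representing it, and [in_qpoly ('X^n - 1)] is the remainder map
   R[x] -> R(n).  The definition of {poly %/ h} replaces h by 'X when h is not
   monic of positive degree, so this is R(n) only for 0 < n. *)
Notation cycalg R n := {poly %/ ('X^n - 1 : {poly R})}.

Notation rem_cyc n f := (in_qpoly ('X^n - 1) f).

Definition base_change (A B : fieldType) (n : nat) (iota : {rmorphism A -> B})
    (c : cycalg A n) : cycalg B n :=
  rem_cyc n (map_poly iota (c : {poly A})).

Definition inv_fourier (L : fieldType) (n : nat) (alpha : L)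
    (g : cycalg L n) : cycalg L n :=
  rem_cyc n (\poly_(i < n) (n%:R^-1 * (g : {poly L}).[alpha ^- i])).

Section Codes.

Variables (F : finFieldType) (n : nat).
Implicit Types (C : {set cycalg F n}) (c : cycalg F n).

(* Ideals of F(n) are the submodules of the regular module.  (The library's
   [idealr_closed] excludes the whole ring, which is a cyclic code.) *)
Definition cyclic_code C : Prop :=
  submod_closed (mem C : {pred (cycalg F n)^o}).

Definition generated_code (m : {poly F}) : {set cycalg F n} :=
  [set a * rem_cyc n m | a : cycalg F n].

Lemma generated_codeP m : cyclic_code (generated_code m).
Proof.
split; first by apply/imsetP; exists 0; rewrite ?mul0r.
move=> a _ _ /imsetP[u _ ->] /imsetP[v _ ->].
by apply/imsetP; exists (a * u + v); rewrite // mulrDl -mulrA.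
Qed.

Definition weight c : nat := #|[set i : 'I_n | (c : {poly F})`_i != 0]|.

(* d(C) = d; in particular C has a nonzero element. *)
Definition min_distance C (d : nat) : Prop :=
  (exists c, [/\ c \in C, c != 0 & weight c = d]) /\
  (forall c, c \in C -> c != 0 -> (d <= weight c)%N).

(* The coefficient in position i moves to position s i. *)
Definition permute_coord (s : 'S_n) c : cycalg F n :=
  rem_cyc n (\sum_(i < n) (c : {poly F})`_i *: 'X^(s i)).

Definition perm_equivalent C1 C2 : Prop :=
  exists s : 'S_n, C2 = [set permute_coord s c | c in C1].

Variables (L : fieldType) (iota : {rmorphism F -> L}).
Implicit Types alpha z : L.

Definition code_zero C z : bool :=
  n.-unity_root z && [forall c in C, root (map_poly iota (c : {poly F})) z].

Definition defining_set alpha C : {set 'I_n} :=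
  [set i : 'I_n | code_zero C (alpha ^+ i)].

Definition consecutive_mod (D : {set 'I_n}) (r : nat) : Prop :=
  exists b : nat, forall j : nat, (j < r)%N ->
    exists2 i : 'I_n, i \in D & i = b + j %[mod n].

Definition BCH_bound C (delta : nat) : Prop :=
  (0 < delta)%N /\
  exists2 alpha, n.-primitive_root alpha &
    consecutive_mod (defining_set alpha C) delta.-1.

(* Delta(C) = delta.  For C = 0 every positive integer is a BCH bound, and
   there is no maximum. *)
Definition max_BCH_bound C (delta : nat) : Prop :=
  BCH_bound C delta /\
  (forall delta', BCH_bound C delta' -> (delta' <= delta)%N).

Definition has_BCH_zeros alpha (delta b : nat) (m : {poly F}) : Prop :=
  forall j : nat, (j < delta.-1)%N ->
    root (map_poly iota m) (alpha ^+ (b + j)).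

Definition BCH_generator alpha (delta b : nat) (m : {poly F}) : Prop :=
  [/\ m \is monic, has_BCH_zeros alpha delta b m &
      forall m' : {poly F}, m' \is monic -> has_BCH_zeros alpha delta b m' ->
        (size m <= size m')%N].

(* C = B_q(alpha, delta, b), with q = #|F|. *)
Definition BCH_code alpha (delta b : nat) C : Prop :=
  exists2 m : {poly F}, BCH_generator alpha delta b m & C = generated_code m.

End Codes.

(* Main.v *)
Require Import Defs.
From mathcomp Require Import all_boot all_order all_fingroup all_algebra all_field.
From mathcomp Require Import ring zify.

Set Implicit Arguments.
Unset Strict Implicit.
Unset Printing Implicit Defensive.

Import GRing.Theory.
Local Open Scope ring_scope.

(* Let r = deg g and let c be the inverse Fourier transform of x^k g at alpha.
   Then c(alpha^t) is the coefficient of x^t in x^k g modulo x^n - 1, which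
   vanishes for the n - r - 1 consecutive exponents t = k + r + 1, ...,
   k + n - 1; hence c lies in B_q(alpha, n - r, k + r + 1).  The coefficients of
   c are, up to the unit alpha^(-ik) / n, the values g(alpha^(-i)), of which
   exactly n - r are nonzero since g divides x^n - 1.  So c is a word of weight
   delta = n - r, and the BCH bound forces Delta = d = delta.  Replacing alpha
   by another primitive root permutes coordinates, both for c and for the
   codes. *)

(** * Residues modulo [x^n - 1] and their representatives of degree below [n] *)

Section CyclicAlgebra.

Variables (R : fieldType) (n : nat).
Hypothesis n_gt0 : (0 < n)%N.

Lemma mk_monic_Xn_sub_1 : mk_monic ('X^n - 1 : {poly R}) = 'X^n - 1.
Proof. by rewrite /mk_monic size_Xn_sub_1 // ltnS n_gt0 monic_Xn_sub_1. Qed.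

Lemma rem_cycE (f : {poly R}) : rem_cyc n f = f %% ('X^n - 1) :> {poly R}.
Proof.
by rewrite /= mk_monic_Xn_sub_1 Pdiv.IdomainMonic.modpE ?monic_Xn_sub_1.
Qed.

Lemma size_cycalg (c : cycalg R n) : (size (c : {poly R}) <= n)%N.
Proof.
apply: leq_trans (size_npoly c) _.
by rewrite mk_monic_Xn_sub_1 size_Xn_sub_1.
Qed.

Lemma rem_cyc_small (f : {poly R}) :
  (size f <= n)%N -> rem_cyc n f = f :> {poly R}.
Proof. by move=> le_fn; rewrite rem_cycE modp_small // size_Xn_sub_1. Qed.

Lemma rem_cycK (c : cycalg R n) : rem_cyc n (c : {poly R}) = c.
Proof. by apply/val_inj/rem_cyc_small/size_cycalg. Qed.

Lemma horner_rem_cyc (f : {poly R}) x :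
  x ^+ n = 1 -> (rem_cyc n f : {poly R}).[x] = f.[x].
Proof.
move=> xn1; rewrite rem_cycE [in RHS](divp_eq f ('X^n - 1)) hornerD hornerM.
by rewrite !hornerE xn1 subrr mulr0 add0r.
Qed.

Lemma horner_cycalg (c : cycalg R n) x :
  (c : {poly R}).[x] = \sum_(i < n) (c : {poly R})`_i * x ^+ i.
Proof. exact: horner_coef_wide (size_cycalg c). Qed.

End CyclicAlgebra.

(** * Extension of scalars *)

Section BaseChange.

Variables (R L : fieldType) (iota : {rmorphism R -> L}) (n : nat).
Hypothesis n_gt0 : (0 < n)%N.

Lemma base_changeE (c : cycalg R n) :
  base_change iota c = map_poly iota (c : {poly R}) :> {poly L}.
Proof. by rewrite /base_change rem_cyc_small ?size_map_poly ?size_cycalg. Qed.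

Lemma base_change_rem (f : {poly R}) :
  base_change iota (rem_cyc n f) = rem_cyc n (map_poly iota f).
Proof.
apply: val_inj; apply: (etrans (base_changeE _)).
apply: etrans (esym (rem_cycE _ _)) => //; rewrite rem_cycE //.
by rewrite map_modp rmorphB rmorph1 /= map_polyXn.
Qed.

End BaseChange.

(** * Orthogonality of roots of unity, Fourier inversion and the BCH bound *)

Lemma sum_prim_rootX (L : fieldType) (n : nat) (alpha : L) (m t : nat) :
    n.-primitive_root alpha -> m != t %[mod n] ->
  \sum_(i < n) alpha ^- i ^+ m * alpha ^+ i ^+ t = 0.
Proof.
move=> alpha_prim neq_mt; have n_gt0 := prim_order_gt0 alpha_prim.
have alpha_neq0 : alpha != 0 by rewrite (prim_root_eq0 alpha_prim) -lt0n.
(* [x] is a nontrivial [n]-th root of unity, so its geometric sum times [x - 1] is [x^n - 1 = 0]. *)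
pose x := alpha ^- m * alpha ^+ t.
have x_neq1 : x - 1 != 0.
  rewrite subr_eq0 /x mulrC -(inj_eq (mulIf (expf_neq0 m alpha_neq0))).
  by rewrite mul1r mulfVK ?expf_neq0 // (eq_prim_root_expr alpha_prim) eq_sym.
rewrite (eq_bigr (fun i : 'I_n => x ^+ i)) => [|i _]; last first.
  by rewrite exprMn !exprVn -!exprM ![(i * _)%N]mulnC.
apply/eqP; have: (x - 1) * \sum_(i < n) x ^+ i == 0.
  rewrite -subrX1 exprMn exprVn -!exprM ![(_ * n)%N]mulnC !exprM.
  by rewrite (prim_expr_order alpha_prim) !expr1n invr1 mul1r subrr.
by rewrite mulf_eq0 (negPf x_neq1).
Qed.

Lemma inv_fourier_coef (L : fieldType) (n : nat) (alpha : L) (f : {poly L})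
    (i : 'I_n) :
    n.-primitive_root alpha ->
  (inv_fourier alpha (rem_cyc n f) : {poly L})`_i = n%:R^-1 * f.[alpha ^- i].
Proof.
move=> alpha_prim; have n_gt0 := prim_order_gt0 alpha_prim.
rewrite /inv_fourier rem_cyc_small ?size_poly // coef_poly ltn_ord.
rewrite horner_rem_cyc // exprVn -exprM mulnC exprM.
by rewrite (prim_expr_order alpha_prim) expr1n invr1.
Qed.

(** After exchanging sums, each [f_m] is multiplied by the orthogonality sum for [m] and [t]. Only
    exponents modulo [n] matter, so [f] may have any degree. *)
Lemma inv_fourier_zero (L : fieldType) (n : nat) (alpha : L) (f : {poly L})
    (t : nat) :
    n.-primitive_root alpha -> (forall m, f`_m != 0 -> m != t %[mod n]) ->
  (inv_fourier alpha (rem_cyc n f) : {poly L}).[alpha ^+ t] = 0.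
Proof.
move=> alpha_prim f_t; have n_gt0 := prim_order_gt0 alpha_prim.
rewrite horner_cycalg //.
under eq_bigr => i _.
  rewrite inv_fourier_coef // horner_coef -mulrA mulr_suml.
  rewrite -exprM mulnC exprM.
  under eq_bigr => m _ do rewrite -mulrA.
  over.
rewrite -mulr_sumr exchange_big big1 ?mulr0 //= => m _.
rewrite -mulr_sumr; have [->|fm_neq0] := eqVneq f`_m 0; first by rewrite mul0r.
by rewrite sum_prim_rootX ?mulr0 ?f_t.
Qed.

(* Pairing the vanishing evaluations with the coefficients of the polynomial P
   whose roots are the locators alpha ^+ s of all support positions s but one
   isolates one nonzero coefficient of f. *)
Lemma BCH_weight (L : fieldType) (n : nat) (alpha : L) (f : {poly L})
    (b r : nat) :
    n.-primitive_root alpha -> (size f <= n)%N -> f != 0 ->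
    (forall j, (j < r)%N -> f.[alpha ^+ (b + j)] = 0) ->
  (r < #|[set i : 'I_n | (f`_i != 0)%R]|)%N.
Proof.
move=> alpha_prim le_fn f_neq0 f_zero; rewrite ltnNge; apply/negP=> le_Sr.
set S := [set i | _] in le_Sr.
have lt_fn : ((size f).-1 < n)%N by rewrite prednK // size_poly_gt0.
(* The position of the leading coefficient: [f != 0] puts it in the support. *)
pose s0 := Ordinal lt_fn.
have Ss0 : s0 \in S by rewrite inE /= -lead_coefE lead_coef_eq0.
pose P := \prod_(s <- enum (S :\ s0)) ('X - (alpha ^+ s)%:P).
(* [P] has degree [#|S| - 1], so under the assumption [#|S| <= r] the [r] evaluations meet all its
   coefficients. *)
have size_P : (size P <= r)%N.
  by rewrite size_prod_XsubC -cardE (leq_trans _ le_Sr) // (cardsD1 s0 S) Ss0.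
have P_s0 : P.[alpha ^+ s0] != 0.
  rewrite horner_prod prodf_seq_neq0; apply/allP=> s.
  rewrite mem_enum !inE !hornerE subr_eq0 (eq_prim_root_expr alpha_prim) !modn_small //.
  by case/andP; rewrite eq_sym.
have: \sum_(j < r) P`_j * f.[alpha ^+ (b + j)] = 0.
  by rewrite big1 // => j _; rewrite f_zero ?mulr0.
(* Position [s] contributes a multiple of [P(alpha^s)], which is zero at every support position
   other than [s0]. *)
have sumE (s : 'I_n) :
    \sum_(j < r) P`_j * (f`_s * (alpha ^+ (b + j)) ^+ s) =
      f`_s * (alpha ^+ s) ^+ b * P.[alpha ^+ s].
  rewrite (horner_coef_wide _ size_P) mulr_sumr; apply: eq_bigr => j _.
  by rewrite -exprM mulnC exprM exprD; ring.
under eq_bigr => j _ do rewrite (horner_coef_wide _ le_fn) mulr_sumr.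
rewrite exchange_big /=; under eq_bigr => s _ do rewrite sumE.
rewrite (bigD1 s0) //= big1 ?addr0 => [/eqP|s neq_s].
  rewrite !mulf_eq0 (negPf P_s0) orbF -lead_coefE lead_coef_eq0 (negPf f_neq0).
  rewrite -exprM expf_eq0 (prim_root_eq0 alpha_prim).
  by rewrite (gtn_eqF (prim_order_gt0 alpha_prim)) andbF.
have [->|fs_neq0] := eqVneq f`_s 0; first by rewrite !mul0r.
rewrite horner_prod (bigD1_seq s) ?enum_uniq ?mem_enum ?inE ?neq_s //=.
by rewrite hornerXsubC subrr mul0r mulr0.
Qed.

(** Serves to build the generator polynomial of a code as the gcd of all its words. *)
Lemma dvdp_big_gcdp (R : fieldType) (I : Type) (r : seq I) (P : pred I)
    (p0 : {poly R}) (f : I -> {poly R}) (d : {poly R}) :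
  (d %| \big[@gcdp R/p0]_(i <- r | P i) f i) =
  (d %| p0) && all (fun i => P i ==> (d %| f i)) r.
Proof.
elim: r => [|i r IHr]; first by rewrite big_nil andbT.
by rewrite big_cons /=; case: (P i) => //=; rewrite dvdp_gcd IHr andbCA.
Qed.

(** * Permutations of the coordinates *)

Lemma permute_coord_coef (F : finFieldType) (n : nat) (s : 'S_n)
    (c : cycalg F n) (i : 'I_n) :
  (permute_coord s c : {poly F})`_(s i) = (c : {poly F})`_i.
Proof.
have n_gt0 : (0 < n)%N by case: (i) => j /(leq_trans _)->.
rewrite rem_cyc_small //; last first.
  apply: (leq_trans (size_sum _ _ _)); apply/bigmax_leqP => j _.
  by rewrite (leq_trans (size_scale_leq _ _)) // size_polyXn ltn_ord.
rewrite coef_sum (bigD1 i) //= coefZ coefXn eqxx mulr1 big1 ?addr0 // => j nji.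
by rewrite coefZ coefXn val_eqE (inj_eq perm_inj) eq_sym (negPf nji) mulr0.
Qed.

Lemma cycalgP (R : fieldType) (n : nat) (c1 c2 : cycalg R n) : (0 < n)%N ->
  (forall i : 'I_n, (c1 : {poly R})`_i = (c2 : {poly R})`_i) -> c1 = c2.
Proof.
move=> n_gt0 eq_c; apply/val_inj/polyP => i /=.
have [lt_in|le_ni] := ltnP i n; first exact: eq_c (Ordinal lt_in).
by rewrite !nth_default // (leq_trans (size_cycalg _ _)).
Qed.

Lemma permute_coordVK (F : finFieldType) (n : nat) (s : 'S_n) (c : cycalg F n) :
  (0 < n)%N -> permute_coord s (permute_coord s^-1%g c) = c.
Proof.
move=> n_gt0; apply: cycalgP => // i.
by rewrite -(permKV s i) permute_coord_coef -{1}(permK s (s^-1 i)%g)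
           permKV permute_coord_coef.
Qed.

Lemma horner_permute_coord (F : finFieldType) (L : fieldType)
    (iota : {rmorphism F -> L}) (n : nat) (s : 'S_n) (c : cycalg F n) (x : L) :
    (0 < n)%N ->
  (map_poly iota (permute_coord s c : {poly F})).[x] =
  \sum_(i < n) iota (c : {poly F})`_i * x ^+ s i.
Proof.
move=> n_gt0; rewrite (@horner_coef_wide _ n) ?size_map_poly ?size_cycalg //.
rewrite (reindex_inj (@perm_inj _ s)) /=; apply: eq_bigr => i _.
by rewrite coef_map permute_coord_coef.
Qed.

(** Every [alpha^i] is an [n]-th root of unity, hence a power of [alpha']; the exponent map is
    injective because the [alpha^i] with [i < n] are distinct. *)
Lemma prim_root_perm (L : fieldType) (n : nat) (alpha alpha' : L) :
    n.-primitive_root alpha -> n.-primitive_root alpha' ->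
  exists s : 'S_n, forall i : 'I_n, alpha ^+ i = alpha' ^+ s i.
Proof.
move=> alpha_prim alpha'_prim.
have expn1 (i : 'I_n) : (alpha ^+ i) ^+ n = 1.
  by rewrite exprAC (prim_expr_order alpha_prim) expr1n.
pose s i := sval (prim_rootP alpha'_prim (expn1 i)).
have sE (i : 'I_n) : alpha ^+ i = alpha' ^+ s i.
  exact: svalP (prim_rootP alpha'_prim (expn1 i)).
have s_inj : injective s.
  move=> i j eq_s; apply/val_inj/eqP; rewrite /= -(modn_small (ltn_ord i)).
  rewrite -[X in _ == X](modn_small (ltn_ord j)).
  by rewrite -(eq_prim_root_expr alpha_prim) !sE eq_s.
by exists (perm s_inj) => i; rewrite permE.
Qed.

(** * BCH codes described by their zeros *)

Section ZeroCodes.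

Variables (F : finFieldType) (L : fieldType) (iota : {rmorphism F -> L}).
Variables (n delta b : nat).

(** The BCH code given by its zeros instead of its generator polynomial; [BCH_code_zero_code]
    identifies the two descriptions. *)
Definition zero_code (alpha : L) : {set cycalg F n} :=
  [set c : cycalg F n |
    [forall j : 'I_delta.-1,
       root (map_poly iota (c : {poly F})) (alpha ^+ (b + j))]].

Lemma zero_codeP alpha (c : cycalg F n) :
  reflect (has_BCH_zeros iota alpha delta b c) (c \in zero_code alpha).
Proof.
rewrite inE; apply: (iffP forallP) => c0 j //; last exact: c0.
by move=> lt_j; exact: c0 (Ordinal lt_j).
Qed.

Lemma has_BCH_zeros_rem alpha (f : {poly F}) : n.-primitive_root alpha ->
  has_BCH_zeros iota alpha delta b (rem_cyc n f : {poly F}) <->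
  has_BCH_zeros iota alpha delta b f.
Proof.
move=> alpha_prim; have n_gt0 := prim_order_gt0 alpha_prim.
suffices rootE j : root (map_poly iota (rem_cyc n f : {poly F})) (alpha ^+ j) =
                   root (map_poly iota f) (alpha ^+ j).
  by split=> f0 j /f0; rewrite rootE.
rewrite /root -base_changeE // base_change_rem // horner_rem_cyc //.
by rewrite exprAC (prim_expr_order alpha_prim) expr1n.
Qed.

(** The generator is the monic gcd of [x^n - 1] and all words: it inherits the prescribed zeros, and
    it divides every polynomial having them. *)
Lemma BCH_code_zero_code alpha : n.-primitive_root alpha ->
  BCH_code iota alpha delta b (zero_code alpha).
Proof.
move=> alpha_prim; have n_gt0 := prim_order_gt0 alpha_prim.
pose P c := c \in zero_code alpha.
(* The default value [x^n - 1] makes [d] nonzero and lets divisibility by [d] pass between a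
   polynomial and its remainder. *)
pose d := \big[@gcdp F/'X^n - 1]_(c : cycalg F n | P c) (c : {poly F}).
have [d_dvd_Xn d_dvd] : d %| 'X^n - 1 /\
    forall c : cycalg F n, P c -> d %| (c : {poly F}).
  have := dvdpp d; rewrite {2}/d dvdp_big_gcdp => /andP[-> /allP all_d].
  by split=> // c Zc; apply: (implyP (all_d c _)) => //; rewrite mem_index_enum.
have d_neq0 : d != 0.
  by apply: contraTneq d_dvd_Xn => ->; rewrite dvd0p monic_neq0 ?monic_Xn_sub_1.
pose m := (lead_coef d)^-1 *: d.
have lc_neq0 : (lead_coef d)^-1 != 0 by rewrite invr_eq0 lead_coef_eq0.
have m_monic : m \is monic.
  by rewrite monicE lead_coefZ mulVf ?lead_coef_eq0.
have dvd_m p : (m %| p) = (d %| p) by rewrite dvdpZl.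
have m_zero : has_BCH_zeros iota alpha delta b m.
  move=> j lt_j; rewrite /m map_polyZ rootZ ?fmorph_eq0 //.
  (* A gcd computed over [F] stays a gcd over [L], so a common root of the words is a root of
     [d]. *)
  rewrite /d; apply: (big_rec (fun p => root (map_poly iota p) _)) => [|c p /zero_codeP/(_ j lt_j) c0 p0]; last first.
    by rewrite gcdp_map root_gcd c0.
  rewrite rmorphB rmorph1 /= map_polyXn /root !hornerE.
  by rewrite exprAC (prim_expr_order alpha_prim) expr1n subrr.
exists m; first split=> // m' m'_monic m'_zero.
  (* The remainder of [m'] modulo [x^n - 1] keeps its zeros, so it is a word and [d] divides it. *)
  have : m %| m'.
    rewrite dvd_m (dvdp_mod _ d_dvd_Xn) -rem_cycE //; apply: d_dvd.
    by apply/zero_codeP/has_BCH_zeros_rem.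
  exact/dvdp_leq/monic_neq0.
apply/setP=> c; apply/idP/imsetP => [Zc | [a _ ->]].
  have : m %| (c : {poly F}) by rewrite dvd_m d_dvd.
  case/dvdpP=> a Dc; exists (rem_cyc n a) => //.
  by rewrite -in_qpolyM -Dc rem_cycK.
rewrite -[a]rem_cycK // -in_qpolyM.
apply/zero_codeP/has_BCH_zeros_rem => // j lt_j.
by rewrite rmorphM rootM m_zero ?orbT.
Qed.

(** Moving coefficient [i] to [s i] while replacing [alpha] by [alpha'] leaves each evaluation at
    exponent [b + j] unchanged. *)
Lemma permute_zero_code (s : 'S_n) (alpha alpha' : L) (c : cycalg F n) :
    (0 < n)%N -> (forall i : 'I_n, alpha ^+ i = alpha' ^+ s i) ->
  (permute_coord s c \in zero_code alpha') = (c \in zero_code alpha).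
Proof.
move=> n_gt0 sE; rewrite !inE; apply: eq_forallb => j; rewrite /root.
rewrite horner_permute_coord // (@horner_coef_wide _ n) ?size_map_poly;
  last exact: size_cycalg.
by congr (_ == 0); apply: eq_bigr => i _; rewrite coef_map exprAC -sE exprAC.
Qed.

Lemma perm_equivalent_zero_code (alpha alpha' : L) :
    n.-primitive_root alpha -> n.-primitive_root alpha' ->
  perm_equivalent (zero_code alpha) (zero_code alpha').
Proof.
move=> alpha_prim alpha'_prim; have n_gt0 := prim_order_gt0 alpha_prim.
have [s sE] := prim_root_perm alpha_prim alpha'_prim.
exists s; apply/setP=> c; apply/idP/imsetP => [Zc | [c' Zc' ->]]; last first.
  by rewrite (permute_zero_code _ _ sE).
exists (permute_coord s^-1%g c); rewrite ?permute_coordVK //.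
by rewrite -(permute_zero_code _ _ sE) ?permute_coordVK.
Qed.

Lemma weight_gt_zeros (alpha : L) (b' r : nat) (c : cycalg F n) :
    n.-primitive_root alpha -> c != 0 ->
    (forall j, (j < r)%N ->
       root (map_poly iota (c : {poly F})) (alpha ^+ (b' + j))) ->
  (r < weight c)%N.
Proof.
move=> alpha_prim c_neq0 c0; have n_gt0 := prim_order_gt0 alpha_prim.
have := @BCH_weight _ n _ (map_poly iota (c : {poly F})) b' r alpha_prim.
rewrite size_map_poly size_cycalg // map_poly_eq0 => /(_ isT c_neq0).
have <- : weight c =
    #|[set i : 'I_n | ((map_poly iota (c : {poly F}))`_i != 0)%R]|.
  by apply: eq_card => i; rewrite !inE coef_map fmorph_eq0.
by apply=> j /c0/rootP.
Qed.

(** Has two uses: it bounds the minimum distance from below, and a single word of low weight bounds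
    all BCH bounds from above. *)
Lemma weight_ge_BCH_bound (delta' : nat) (C : {set cycalg F n})
    (c : cycalg F n) :
    c \in C -> c != 0 -> BCH_bound iota C delta' -> (delta' <= weight c)%N.
Proof.
move=> Cc c_neq0 [delta'_gt0 [gamma gamma_prim [b' Db']]].
rewrite -(prednK delta'_gt0); apply: (weight_gt_zeros (b' := b') gamma_prim c_neq0) => j.
case/Db'=> i; rewrite inE => /andP[_ /forall_inP/(_ c Cc) c0] eq_i.
by rewrite -(prim_expr_mod gamma_prim (b' + j)) -eq_i prim_expr_mod.
Qed.

Lemma zero_code_BCH_bound alpha : (0 < delta)%N -> n.-primitive_root alpha ->
  BCH_bound iota (zero_code alpha) delta.
Proof.
move=> delta_gt0 alpha_prim; have n_gt0 := prim_order_gt0 alpha_prim.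
split=> //; exists alpha => //; exists b => j lt_j.
exists (Ordinal (ltn_pmod (b + j) n_gt0)); last by rewrite /= modn_mod.
rewrite inE /= prim_expr_mod // /code_zero; apply/andP; split.
  by apply/unity_rootP; rewrite exprAC (prim_expr_order alpha_prim) expr1n.
by apply/forall_inP=> c /zero_codeP; apply.
Qed.

End ZeroCodes.

(* Changing the root of unity permutes the coefficients of the inverse Fourier
   transform, so membership in F(n) does not depend on that root. *)
Lemma inv_fourier_descent (F : finFieldType) (L : fieldType)
    (iota : {rmorphism F -> L}) (n : nat) (alpha beta : L) (f : {poly L})
    (c : cycalg F n) :
    n.-primitive_root beta -> n.-primitive_root alpha ->
    base_change iota c = inv_fourier beta (rem_cyc n f) ->
  exists c', base_change iota c' = inv_fourier alpha (rem_cyc n f).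
Proof.
move=> beta_prim alpha_prim Dc; have n_gt0 := prim_order_gt0 alpha_prim.
have [s sE] := prim_root_perm beta_prim alpha_prim.
exists (permute_coord s c); apply: cycalgP => // i.
(* Both coefficients are the value of [f] at the same root of unity, divided by [n]. *)
rewrite -(permKV s i) inv_fourier_coef // -sE -inv_fourier_coef // -Dc.
by rewrite !base_changeE // !coef_map permute_coord_coef.
Qed.

(** * The inverse Fourier transform of a shifted divisor of [x^n - 1] *)

Section ShiftedDivisor.

Variables (L : fieldType) (n k : nat) (alpha : L) (h : {poly L}).
Hypotheses (alpha_prim : n.-primitive_root alpha).
Hypotheses (h_dvd : h %| 'X^n - 1) (deg_h : ((size h).-1 < n)%N).

Local Notation phi := (inv_fourier alpha (rem_cyc n ('X^k * h)) : {poly L}).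

Let n_gt0 : (0 < n)%N := prim_order_gt0 alpha_prim.

Let h_neq0 : h != 0.
Proof.
by apply: contraTneq h_dvd => ->; rewrite dvd0p monic_neq0 ?monic_Xn_sub_1.
Qed.

(** The shift only contributes a power of [alpha], and [n] is invertible in [L] because a primitive
    [n]-th root exists. *)
Lemma inv_fourier_shift_eq0 (i : 'I_n) : (phi`_i == 0) = root h (alpha ^- i).
Proof.
rewrite inv_fourier_coef // mulf_eq0 invr_eq0.
rewrite (negPf (prim_root_natf_neq0 alpha_prim)) /root hornerM hornerXn mulf_eq0.
rewrite expf_eq0 invr_eq0 expf_eq0 (prim_root_eq0 alpha_prim).
by rewrite (gtn_eqF n_gt0) !andbF.
Qed.

Lemma prim_rootV_uniq (A : {set 'I_n}) :
  uniq [seq alpha ^- i | i : 'I_n <- enum A].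
Proof.
rewrite map_inj_uniq ?enum_uniq // => i j /invr_inj/eqP.
rewrite (eq_prim_root_expr alpha_prim) !modn_small ?ltn_ord // => /eqP.
exact: val_inj.
Qed.

(** Write [x^n - 1 = h' * h]. A support position [i] makes [alpha^-i] a root of [h'], which has at
    most [n - deg h] roots. *)
Lemma inv_fourier_shift_weight :
  (#|[set i : 'I_n | (phi`_i != 0)%R]| <= n - (size h).-1)%N.
Proof.
set S := [set i | _].
have Dh := divpK h_dvd; set h' := _ %/ h in Dh.
have h'_neq0 : h' != 0.
  apply: contra_eq_neq Dh => ->.
  by rewrite mul0r eq_sym monic_neq0 ?monic_Xn_sub_1.
have all_h' : all (root h') [seq alpha ^- i | i : 'I_n <- enum S].
  apply/allP=> _ /mapP[i Si ->]; move: Si.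
  rewrite mem_enum inE inv_fourier_shift_eq0 => hi_neq0.
  have : root ('X^n - 1) (alpha ^- i).
    rewrite /root !hornerE exprVn exprAC (prim_expr_order alpha_prim) expr1n.
    by rewrite invr1 subrr.
  by rewrite -Dh rootM (negPf hi_neq0) orbF.
have := max_poly_roots h'_neq0 all_h' (prim_rootV_uniq S).
by rewrite size_map -cardE size_divp // size_Xn_sub_1 // (subSn (ltnW deg_h)).
Qed.

(** Otherwise [h], of degree below [n], would vanish at all [n] roots of unity. *)
Lemma inv_fourier_shift_neq0 : phi != 0.
Proof.
apply/eqP=> phi0.
have all_h : all (root h) [seq alpha ^- i | i : 'I_n <- enum [set: 'I_n]].
  by apply/allP=> _ /mapP[i _ ->]; rewrite -inv_fourier_shift_eq0 phi0 coef0.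
have := max_poly_roots h_neq0 all_h (prim_rootV_uniq _).
rewrite size_map -cardE cardsT card_ord => lt_nh.
by move: deg_h; rewrite -ltnS prednK ?(ltn_trans n_gt0) // ltnS leqNgt lt_nh.
Qed.

Lemma inv_fourier_shift_zero (j : nat) :
    (j < (n - (size h).-1).-1)%N ->
  phi.[alpha ^+ ((k + size h) %% n + j)] = 0.
Proof.
move=> lt_j; rewrite inv_fourier_zero // => m; rewrite coefXnM.
case: ltnP => [_|le_km]; first by rewrite eqxx.
rewrite -{2}(subnKC le_km); set m' := (m - k)%N => hm'.
have lt_m' : (m' < size h)%N.
  by rewrite ltnNge; apply: contra hm' => le_m'; rewrite nth_default.
have h_gt0 : (0 < size h)%N by rewrite size_poly_gt0.
(* With [k] cancelled, [m' < size h <= size h + j < n], so the two exponents differ modulo [n]. *)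
rewrite modnDml -addnA eqn_modDl !modn_small; lia.
Qed.

End ShiftedDivisor.

Theorem theorem24 (n p e q : nat) (F : finFieldType) (K L : fieldType)
    (iota : {rmorphism F -> K}) (kappa : {rmorphism K -> L})
    (n_gt0 : (0 < n)%N) (p_prime : prime p) (e_gt0 : (0 < e)%N)
    (q_def : q = (p ^ e)%N) (card_F : #|F| = q) (co_nq : coprime n q)
    (U_sub_L : exists zeta : L, n.-primitive_root zeta)
    (g : {poly K}) (g_dvd : g %| 'X^n - 1) (deg_g : ((size g).-1 < n)%N)
    (k : 'I_n) (beta : L) (beta_prim : n.-primitive_root beta)
    (phi_beta : exists c : cycalg F n,
       base_change (kappa \o iota) c =
       inv_fourier beta (base_change kappa (rem_cyc n ('X^k * g)))) :
  let delta := (n - (size g).-1)%N in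
  exists (b : 'I_n) (C : L -> {set cycalg F n}),
    [/\ forall alpha : L, n.-primitive_root alpha ->
          BCH_code (kappa \o iota) alpha delta b (C alpha),
        forall alpha alpha' : L,
          n.-primitive_root alpha -> n.-primitive_root alpha' ->
          perm_equivalent (C alpha) (C alpha')
      & forall alpha : L, n.-primitive_root alpha ->
          [/\ max_BCH_bound (kappa \o iota) (C alpha) delta,
              min_distance (C alpha) delta
            & exists2 c : cycalg F n, c \in C alpha &
                base_change (kappa \o iota) c =
                inv_fourier alpha
                  (base_change kappa (rem_cyc n ('X^k * g)))]].

Proof.
pose psi : {rmorphism F -> L} := kappa \o iota.
pose h := map_poly kappa g.
have size_h : size h = size g by rewrite size_map_poly.
have deg_h : ((size h).-1 < n)%N by rewrite size_h.
have h_dvd : h %| 'X^n - 1.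
  have -> : 'X^n - 1 = map_poly kappa ('X^n - 1).
    by rewrite rmorphB rmorph1 /= map_polyXn.
  by rewrite dvdp_map.
rewrite base_change_rem // rmorphM /= map_polyXn -/h -/psi in phi_beta *.
pose delta := (n - (size g).-1)%N; rewrite -/delta.
(* As [size g = deg g + 1], this is the exponent just after the top one of [x^k g], modulo [n]. *)
pose b := Ordinal (ltn_pmod (k + size g) n_gt0).
exists b, (zero_code psi n delta b); split=> [alpha alpha_prim||alpha alpha_prim].
- exact: BCH_code_zero_code.
- exact: perm_equivalent_zero_code.
have delta_gt0 : (0 < delta)%N by rewrite subn_gt0.
have [c0 Dc0] := phi_beta.
have [c Dc] := inv_fourier_descent beta_prim alpha_prim Dc0.
have Dc' : map_poly psi (c : {poly F}) =
    inv_fourier alpha (rem_cyc n ('X^k * h)) :> {poly L}.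
  by rewrite -Dc base_changeE.
have Cc : c \in zero_code psi n delta b alpha.
  apply/zero_codeP=> j lt_j; apply/rootP; rewrite Dc' /= -size_h.
  by rewrite inv_fourier_shift_zero // size_h.
have c_neq0 : c != 0.
  have := inv_fourier_shift_neq0 k alpha_prim h_dvd deg_h.
  by rewrite -Dc' map_poly_eq0.
have BCH_delta := zero_code_BCH_bound psi b delta_gt0 alpha_prim.
(* The BCH bound gives one inequality, the count of nonzero values of [h] the other. *)
have weight_c : weight c = delta.
  apply/eqP; rewrite eqn_leq (weight_ge_BCH_bound Cc c_neq0 BCH_delta) andbT.
  rewrite /delta -size_h.
  apply: leq_trans (inv_fourier_shift_weight k alpha_prim h_dvd deg_h).
  rewrite -Dc' subset_leq_card //; apply/subsetP=> i.
  by rewrite !inE coef_map fmorph_eq0.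
split.
- split=> // delta' /(weight_ge_BCH_bound Cc c_neq0).
  by rewrite weight_c.
- split; first by exists c.
  by move=> c' Cc' c'_neq0; apply: weight_ge_BCH_bound Cc' c'_neq0 BCH_delta.
- by exists c.
Qed.
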